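(* Every graph $G$ with $\sigma(G) = k \ge 3$ satisfies $\chi(G) \le k + 2^{2^{k-1}-k-1}$. Thus $$k \ge \log_2\left(\log_2(\chi(G)-k) + k + 1\right).$$
   Context: $\chi(G)$ is the chromatic number of $G$. An orientation covering of $G$ is a set of orientations $\overrightarrow{G_1},\dots,\overrightarrow{G_k}$ of $G$ such that for every vertex $u$ and any two distinct neighbors $v,w$ of $u$, some $\overrightarrow{G_i}$ contains both arcs $\overrightarrow{uv}$ and $\overrightarrow{uw}$. $\sigma(G)$ is the minimum size of an orientation covering of $G$. *)

(* Defs.v *)
From HB Require Import structures.
From mathcomp Require Import all_boot all_order all_algebra.
From mathcomp Require Import reals exp.

Set Implicit Arguments.
Unset Strict Implicit.
Unset Printing Implicit Defensive.

Import Order.TTheory GRing.Theory Num.Theory.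

Record sgraph := SGraph {
  vertex :> finType;
  adj : rel vertex;
  adj_sym : symmetric adj;
  adj_irrefl : irreflexive adj }.

Section Coloring.
Variable G : sgraph.

Definition proper_coloring k (c : {ffun G -> 'I_k}) : bool :=
  [forall x : G, forall y : G, adj x y ==> (c x != c y)].

Definition colorable k : bool :=
  [exists c : {ffun G -> 'I_k}, proper_coloring c].

Lemma colorable_exists : exists k, colorable k.
Proof.
exists #|G|; apply/existsP; exists [ffun x => enum_rank x].
apply/forallP=> x; apply/forallP=> y; apply/implyP=> xy; rewrite !ffunE.
by apply: contraTneq xy => /enum_rank_inj->; rewrite adj_irrefl.
Qed.

Definition chromatic_number : nat := ex_minn colorable_exists.

End Coloring.

Section OrientationCovering.
Variable G : sgraph.

(* D is a set of arcs; (x, y) \in D is the arc from x to y. *)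
Definition is_orientation (D : {set G * G}) : bool :=
  [forall x : G, forall y : G,
     (((x, y) \in D) ==> adj x y) &&
     (adj x y ==> (((x, y) \in D) (+) ((y, x) \in D)))].

Definition is_orientation_covering (C : {set {set G * G}}) : bool :=
  [forall D in C, is_orientation D] &&
  [forall u : G, forall v : G, forall w : G,
     [&& adj u v, adj u w & v != w] ==>
     [exists D in C, ((u, v) \in D) && ((u, w) \in D)]].

Definition has_orientation_covering k : bool :=
  [exists C : {set {set G * G}}, is_orientation_covering C && (#|C| == k)].

Lemma orientation_covering_exists : exists k, has_orientation_covering k.
Proof.
pose C := [set D | is_orientation D].
exists #|C|; apply/existsP; exists C; rewrite eqxx andbT.
apply/andP; split; first by apply/forall_inP=> D; rewrite inE.
apply/forallP=> u; apply/forallP=> v; apply/forallP=> w.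
apply/implyP=> /and3P[uv uw _].
pose D := [set p : G * G | adj p.1 p.2 &&
  ((p.1 == u) || (p.2 != u) && (enum_rank p.1 < enum_rank p.2)%N)].
apply/existsP; exists D; rewrite !inE /= uv uw eqxx !andbT.
apply/forallP=> x; apply/forallP=> y; rewrite !inE /= (adj_sym y x).
case xy: (adj x y) => //=; rewrite implybT /=.
have nxy : x != y by apply: contraTneq xy => ->; rewrite adj_irrefl.
case: (eqVneq x u) => [xu|_] /=; case: (eqVneq y u) => [yu|_] //=.
  by rewrite xu yu eqxx in nxy.
case: ltngtP => // /val_inj/enum_rank_inj exy.
by rewrite exy eqxx in nxy.
Qed.

Definition orientation_covering_number : nat :=
  ex_minn orientation_covering_exists.

End OrientationCovering.

(* Since ln x = 0 for x <= 0, log2 x = 0 for x <= 0. *)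
Definition log2 (R : realType) (x : R) : R := (ln x / ln 2)%R.

(* Main.v *)
Require Import Defs.
From HB Require Import structures.
From mathcomp Require Import all_boot all_order all_algebra.
From mathcomp Require Import reals exp.
From mathcomp Require Import zify.

Import Order.TTheory GRing.Theory Num.Theory.

(** Label each arc uv by the set S u v of the orientations that contain it, so
    that S v u is the complement of S u v, and the labels at a fixed vertex
    meet pairwise.  Color u by i if some label at u is the singleton {i}, and
    otherwise by the family of labels at u.  Since an intersecting family never
    contains two complementary sets, this coloring is proper; moreover, only one
    set out of each complementary pair has to be recorded, and the pairs
    {∅, T} and {{i}, T \ {i}} carry no information, which leaves
    2^(k-1) - k - 1 of the 2^(k-1) pairs.  An empty label at u forces u to be a
    leaf, which is recolored afterwards. *)

(** * Colorings with values in a finite type *)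

Lemma proper_map_colorable (G : sgraph) (K : finType) (n : nat) (c : G -> K) :
  (forall u v, adj u v -> c u != c v) -> #|K| <= n -> colorable G n.
Proof.
move=> c_proper leKn; apply/existsP.
exists [ffun u => widen_ord leKn (enum_rank (c u))].
apply/forallP=> u; apply/forallP=> v; apply/implyP=> uv; rewrite !ffunE.
apply: contraNneq (c_proper u v uv) => /(congr1 val)/= /val_inj.
by move=> /enum_rank_inj ->.
Qed.

Lemma chromatic_number_le (G : sgraph) (n : nat) :
  colorable G n -> chromatic_number G <= n.
Proof.
by move=> Gn; rewrite /chromatic_number; case: ex_minnP => m _; apply.
Qed.

(** * Counting nontrivial complementary pairs *)

Section ComplementaryPairs.
Variables (T : finType) (t : T).

(* The representative of a complementary pair is its member avoiding t. *)
Definition trivial_reps : {set {set T}} :=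
  set0 |: ([set~ t] |: [set [set x] | x in [set~ t]]).

Definition nontrivial_reps : {set {set T}} :=
  powerset [set~ t] :\: trivial_reps.

(** [[set~ t]] represents the pair of {t}. With at least three elements it is neither empty nor a
    singleton, so the three kinds do not overlap and the count is 1 + 1 + (#|T| - 1). *)
Lemma card_trivial_reps : 2 < #|T| -> #|trivial_reps| = #|T|.+1.
Proof.
move=> T3; rewrite /trivial_reps !cardsU1 card_imset; last exact: set1_inj.
have cB : #|[set~ t]| = #|T|.-1 by rewrite cardsC1.
have -> : (set0 \notin [set~ t] |: [set [set x] | x in [set~ t]]) = true.
  rewrite !inE negb_or; apply/andP; split.
    by apply/eqP => /(congr1 (fun A : {set T} => #|A|)); rewrite cB cards0; lia.
  apply/imsetP => -[x _] /(congr1 (fun A : {set T} => #|A|)).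
  by rewrite cards0 cards1.
have -> : ([set~ t] \notin [set [set x] | x in [set~ t]]) = true.
  apply/imsetP => -[x _] /(congr1 (fun A : {set T} => #|A|)).
  by rewrite cB cards1; lia.
by rewrite cB; lia.
Qed.

Lemma card_nontrivial_reps :
  2 < #|T| -> #|nontrivial_reps| = 2 ^ (#|T| - 1) - #|T| - 1.
Proof.
move=> T3; have sub : trivial_reps \subset powerset [set~ t].
  apply/subsetP => A; rewrite !inE => /orP[/eqP->|/orP[/eqP->|]] //.
    exact: sub0set.
  by case/imsetP => x xt ->; rewrite sub1set.
rewrite /nontrivial_reps cardsD (setIidPr sub) card_trivial_reps //.
by rewrite card_powerset cardsC1 -subnDA addn1 subn1.
Qed.

Lemma nontrivial_repsP (A : {set T}) :
  t \notin A -> A != set0 -> (forall x, A != [set x]) ->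
  (forall x, ~: A != [set x]) -> A \in nontrivial_reps.
Proof.
move=> tA A0 A1 AC1; rewrite in_setD powersetE -setCS setCK sub1set.
rewrite in_setC tA andbT /trivial_reps !inE (negPf A0) /= negb_or; apply/andP; split.
  by apply: contraNneq (AC1 t) => ->; rewrite setCK.
by apply/imsetP => -[x _ AE]; move: (A1 x); rewrite AE eqxx.
Qed.

End ComplementaryPairs.

(** * Coloring by labels *)

Section LabelColoring.
Variables (G : sgraph) (T : finType) (S : G -> G -> {set T}) (t t' : T).
Hypothesis t'_neq : t' != t.
Hypothesis S_rev : forall u v, adj u v -> S v u = ~: S u v.
Hypothesis S_meet : forall u v w, adj u v -> adj u w -> v != w ->
  S u v :&: S u w != set0.

Definition label_at (u : G) (A : {set T}) : bool :=
  [exists v, adj u v && (S u v == A)].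

(** The sigma type keeps the codomain exactly as large as the number of colors allowed. *)
Definition label_color (u : G) : T + {set {A | A \in nontrivial_reps T t}} :=
  if [pick x | label_at u [set x]] is Some x then inl x
  else inr [set A | label_at u (val A)].

(** If both labels come from the same neighbor they coincide, and the absence of [set0] takes the
    place of [S_meet]. *)
Lemma labels_meet (u : G) (A B : {set T}) : ~~ label_at u set0 ->
  label_at u A -> label_at u B -> A :&: B != set0.
Proof.
move=> u0 /existsP[v /andP[uv /eqP<-]] /existsP[w /andP[uw /eqP<-]].
have [<-|] := eqVneq v w; last exact: S_meet.
rewrite setIid; apply: contraNneq u0 => Suv.
by apply/existsP; exists v; rewrite uv Suv eqxx.
Qed.

Lemma label_at_compl (u : G) (A : {set T}) : ~~ label_at u set0 ->
  label_at u A -> ~~ label_at u (~: A).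
Proof.
move=> u0 uA; apply/negP => uCA.
by have := labels_meet _ _ _ u0 uA uCA; rewrite setICr eqxx.
Qed.

Lemma label_color_proper (u v : G) :
  ~~ label_at u set0 -> ~~ label_at v set0 -> adj u v ->
  label_color u != label_color v.
Proof.
move=> u0 v0 uv.
have vu : adj v u by rewrite adj_sym.
have uA : label_at u (S u v) by apply/existsP; exists v; rewrite uv eqxx.
have vA : label_at v (~: S u v).
  by apply/existsP; exists u; rewrite vu S_rev ?eqxx.
have uCA := label_at_compl u _ u0 uA.
have vCA : ~~ label_at v (S u v).
  by rewrite -[S u v]setCK; apply: label_at_compl.
rewrite /label_color.
case: pickP => [x ux|u1]; case: pickP => [y vy|v1] //.
  (* A shared singleton {x} would put x in both [S u v] and its complement. *)
  apply/eqP => -[xy]; rewrite -{y}xy in vy.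
  have := labels_meet _ _ _ v0 vy vA; have := labels_meet _ _ _ u0 ux uA.
  case/set0Pn=> y; rewrite !inE => /andP[/eqP-> xS].
  by case/set0Pn=> z; rewrite !inE => /andP[/eqP->]; rewrite xS.
(* Neither member of the pair is a singleton, so the one avoiding t is recorded; it is a label at
   exactly one of u and v. *)
have A1 x : S u v != [set x] by apply: contraFneq (u1 x) => <-.
have CA1 x : ~: S u v != [set x] by apply: contraFneq (v1 x) => <-.
apply/eqP => -[] /setP E.
have [tS|tS] := boolP (t \in S u v).
  have Ain : ~: S u v \in nontrivial_reps T t.
    apply: nontrivial_repsP; rewrite ?setCK //; first by rewrite inE tS.
    by apply: contraNneq v0 => <-.
  by have := E (exist (fun A => A \in nontrivial_reps T t) _ Ain);
    rewrite !inE /= vA (negPf uCA).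
have Ain : S u v \in nontrivial_reps T t.
  by apply: nontrivial_repsP => //; apply: contraNneq u0 => <-.
by have := E (exist (fun A => A \in nontrivial_reps T t) _ Ain);
  rewrite !inE /= uA (negPf vCA).
Qed.

(** The empty label meets no label, so a second neighbor is impossible. *)
Lemma label0_leaf (u v w : G) :
  label_at u set0 -> adj u v -> adj u w -> v = w.
Proof.
case/existsP => x /andP[ux /eqP Sux].
suff eq_x y : adj u y -> y = x by move=> /eq_x -> /eq_x ->.
move=> uy; apply/eqP; apply: contraTT isT => yx.
by have := S_meet _ _ _ uy ux yx; rewrite Sux setI0 eqxx.
Qed.

(** Otherwise u and v are leaves joined to each other, so [S u v] and its complement are both empty,
    although T contains t. *)
Lemma label0_adj (u v : G) :
  adj u v -> label_at u set0 -> ~~ label_at v set0.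
Proof.
move=> uv u0; apply/negP => v0; have vu : adj v u by rewrite adj_sym.
have Suv : S u v = set0.
  case/existsP: (u0) => x /andP[ux /eqP<-].
  by rewrite (label0_leaf u v x).
have Svu : S v u = set0.
  case/existsP: (v0) => x /andP[vx /eqP<-].
  by rewrite (label0_leaf v u x).
by have /setP/(_ t) := S_rev _ _ uv; rewrite Svu Suv !inE.
Qed.

(** A leaf has one color to avoid, so two existing colors suffice. Testing [label_color v] is sound
    because, by [label0_adj], the neighbor is not recolored. *)
Definition leaf_recoloring (u : G) :=
  if label_at u set0 then
    if [exists v, adj u v && (label_color v == inl t)] then inl t' else inl t
  else label_color u.

Lemma leaf_recoloring_proper (u v : G) :
  adj u v -> leaf_recoloring u != leaf_recoloring v.
Proof.
have leaf x y : adj x y -> label_at x set0 ->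
    leaf_recoloring x != leaf_recoloring y.
  move=> xy x0; rewrite /leaf_recoloring x0 (negPf (label0_adj _ _ xy x0)).
  case: existsP => [[z /andP[xz /eqP cz]]|no].
    by rewrite (label0_leaf x y z) // cz; apply: contraNneq t'_neq => -[->].
  by apply/eqP => cy; apply: no; exists y; rewrite xy cy eqxx.
move=> uv; have [u0|u0] := boolP (label_at u set0); first exact: leaf.
have [v0|v0] := boolP (label_at v set0).
  by rewrite eq_sym; apply: leaf; rewrite // adj_sym.
by rewrite /leaf_recoloring (negPf u0) (negPf v0); apply: label_color_proper.
Qed.

Lemma labels_colorable : 2 < #|T| ->
  colorable G (#|T| + 2 ^ (2 ^ (#|T| - 1) - #|T| - 1)).
Proof.
move=> T3; apply: (proper_map_colorable _ _ _ _ leaf_recoloring_proper).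
rewrite card_sum -(cardsT {set _}) -powersetT card_powerset cardsT card_sig.
by rewrite -(card_nontrivial_reps _ t T3).
Qed.

End LabelColoring.

Lemma orientation_covering_colorable (G : sgraph) (k : nat) :
  has_orientation_covering G k -> 2 < k ->
  colorable G (k + 2 ^ (2 ^ (k - 1) - k - 1)).
Proof.
case/existsP => C /andP[/andP[/forall_inP Cor /forallP Ccov] /eqP Ck] k3.
pose T : finType := {D | D \in C}.
have Tk : #|T| = k by rewrite card_sig.
have /card_gt1P[t [t' [_ _ tt']]] : 1 < #|T| by rewrite Tk ltnW.
rewrite -Tk; apply: (labels_colorable _ _
  (fun u v => [set D : T | (u, v) \in val D]) t t'); rewrite ?Tk //.
- by rewrite eq_sym.
- move=> u v uv; apply/setP => D; rewrite !inE.
  have /forallP/(_ u)/forallP/(_ v)/andP[_] := Cor _ (valP D).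
  by rewrite uv /=; do 2!case: (_ \in _).
- move=> u v w uv uw vw.
  have /forallP/(_ v)/forallP/(_ w) := Ccov u.
  rewrite uv uw vw => /exists_inP[D DC uD].
  by apply/set0Pn; exists (exist (fun D => D \in C) D DC); rewrite !inE.
Qed.

Section Log2.
Variable R : realType.
Local Open Scope ring_scope.

Lemma ln2_gt0 : 0 < ln 2 :> R.
Proof. by rewrite ln_gt0 // ltr1n. Qed.

Lemma log2_natX (n : nat) : log2 (2 ^ n)%:R = n%:R :> R.
Proof.
rewrite /log2 natrX lnXn ?ltr0n // -[ln 2 *+ n]mulr_natl mulfK //.
by rewrite gt_eqF ?ln2_gt0.
Qed.

Lemma log2_le_nat (x : R) (n : nat) : x <= (2 ^ n)%:R -> log2 x <= n%:R.
Proof.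
move=> xn; have [x0|x0] := leP x 0.
  (* This case arises when the chromatic number is at most k; the default value 0 settles it. *)
  by rewrite /log2 ln0 // mul0r ler0n.
rewrite -log2_natX /log2 ler_pM2r ?invr_gt0 ?ln2_gt0 // ler_ln // posrE.
by rewrite ltr0n expn_gt0.
Qed.

End Log2.

(** Ensures that the subtraction in the exponent is not truncated; equality holds at k = 3. *)
Lemma leq_succ_exp2 (k : nat) : 2 < k -> k + 1 <= 2 ^ (k - 1).
Proof.
case: k => [|k] //; rewrite ltnS subn1 /=.
elim: k => [|k IH] //; rewrite ltnS leq_eqVlt => /orP[/eqP<- //|/IH].
by rewrite expnS; lia.
Qed.

Theorem theorem13 (R : realType) (G : sgraph) (k : nat) :
  orientation_covering_number G = k ->
  (3 <= k)%N ->
  (chromatic_number G <= k + 2 ^ (2 ^ (k - 1) - k - 1))%N /\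
  (log2 (log2 ((chromatic_number G)%:R - k%:R) + k%:R + 1) <= k%:R :> R)%R.
Proof.
move=> Gk k3.
have chi_le : chromatic_number G <= k + 2 ^ (2 ^ (k - 1) - k - 1).
  apply: chromatic_number_le; apply: orientation_covering_colorable => //.
  by rewrite -Gk /orientation_covering_number; case: ex_minnP.
split=> //; apply: log2_le_nat.
have log_chi : (log2 ((chromatic_number G)%:R - k%:R)
    <= (2 ^ (k - 1) - k - 1)%:R :> R)%R.
  by apply: log2_le_nat; rewrite lerBlDl -natrD ler_nat.
(* Adding k + 1 to the exponent bound gives exactly 2^(k - 1). *)
apply: (@le_trans _ _ (2 ^ (k - 1))%:R%R); last first.
  by rewrite ler_nat leq_pexp2l // leq_subr.
rewrite -addrA natr1 -(addn1 k) -lerBrDr; apply: le_trans log_chi _.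
by rewrite -natrB ?leq_succ_exp2 // subnDA.
Qed.
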